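(* Suppose $G$ is a simple graph with $n$ vertices and $k>1$ connected components. If $\Phi=\{\phi_i\}_{i\in[n]}$ is an $L_G(n,n-k)$-frame for $\mathbb{C}^{n-k}$ with frame operator $S_\Phi$, then there exists an alternate dual frame of $\Phi$ (a dual frame different from the canonical dual frame $S_\Phi^{-1}\Phi$) which is a spectrally optimal dual frame of $\Phi$ for $2$-erasures.
   Context: Write $[n]=\{1,\dots,n\}$; inner products on $\mathbb{C}^d$ are standard and linear in the first argument. A finite sequence $\Phi=\{\phi_i\}_{i\in[n]}$ in $\mathbb{C}^d$ is a frame for $\mathbb{C}^d$ if there are constants $0<A\le B$ with $A\|f\|^2\le\sum_{i\in[n]}|\langle f,\phi_i\rangle|^2\le B\|f\|^2$ for all $f\in\mathbb{C}^d$. Its frame operator is $S_\Phi f=\sum_{i\in[n]}\langle f,\phi_i\rangle\phi_i$ (invertible). A frame $\Psi=\{\psi_i\}_{i\in[n]}$ of $\mathbb{C}^d$ is a dual frame of $\Phi$ if $f=\sum_{i\in[n]}\langle f,\phi_i\rangle\psi_i=\sum_{i\in[n]}\langle f,\psi_i\rangle\phi_i$ for all $f\in\mathbb{C}^d$; $D_\Phi$ denotes the set of dual frames of $\Phi$. The canonical dual frame of $\Phi$ is $S_\Phi^{-1}\Phi:=\{S_\Phi^{-1}\phi_i\}_{i\in[n]}\in D_\Phi$; all other dual frames are called alternate dual frames. Spectral optimality: for $\Psi\in D_\Phi$ and $\Lambda\subset[n]$, the error operator is $E_{\Phi,\Psi,\Lambda}(f)=\sum_{i\in\Lambda}\langle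 f,\phi_i\rangle\psi_i$ on $\mathbb{C}^d$, and for $1\le r<n$, $\rho^{(r)}_{\Phi,\Psi}:=\max\{\rho(E_{\Phi,\Psi,\Lambda}):\Lambda\subset[n],\ |\Lambda|=r\}$, where $\rho(\cdot)$ is the spectral radius. Put $\rho^{(r)}_\Phi:=\min\{\rho^{(r)}_{\Phi,\widetilde\Psi}:\widetilde\Psi\in D_\Phi\}$. $\Psi\in D_\Phi$ is a spectrally optimal dual frame of $\Phi$ for $1$-erasure if $\rho^{(1)}_{\Phi,\Psi}=\rho^{(1)}_\Phi$. $\Psi$ is a spectrally optimal dual frame of $\Phi$ for $2$-erasures if it is a spectrally optimal dual frame for $1$-erasure and $\rho^{(2)}_{\Phi,\Psi}=\rho^{(2)}_\Phi$ (the minimum being over all of $D_\Phi$). Graph frames: for a simple graph $G$ with $n$ vertices $v_1,\dots,v_n$ and $n-m$ connected components, the Laplacian matrix is $L(G)=D(G)-A(G)$ (degree matrix minus adjacency matrix); it has rank $m$. Write $L(G)=M\,\mathrm{diag}(\lambda_1,\dots,\lambda_m,0,\dots,0)\,M^*$ with $M$ unitary and $\lambda_1,\dots,\lambda_m$ the nonzero eigenvalues, let $M_1$ be the submatrix formed by the first $m$ columns of $M$, and let $B=\mathrm{diag}(\sqrt{\lambda_1},\dots,\sqrt{\lambda_m})M_1^*$. Then $\{B e_i\}_{i\in[n]}$, with $\{e_i\}$ the standard basis of $\mathbb{C}^n$, is a frame for $\mathbb{C}^m$; any frame arising in this way is called an $L_G(n,m)$-frame. *)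

(* Defs.v *)
From HB Require Import structures.
From mathcomp Require Import all_boot all_order all_algebra.
From mathcomp Require Import sesquilinear spectral complex.
From mathcomp Require Import classical_sets reals.

Set Implicit Arguments.
Unset Strict Implicit.
Unset Printing Implicit Defensive.

Import Order.TTheory GRing.Theory Num.Theory.
Local Open Scope ring_scope.
Local Open Scope complex_scope.
Local Open Scope sesquilinear_scope.

(* Vectors of C^d are row vectors over R[i], the complex numbers over the reals
   R.  [dotmx u v] is the inner product [(u *m v ^t* ) 0 0], linear in [u].
   Following the library, a matrix acts on row vectors from the right. *)

Definition is_frame (R : realType) (n d : nat)
    (Phi : {ffun 'I_n -> 'rV[R[i]]_d}) : Prop :=
  exists A B : R, 0 < A /\ A <= B /\ forall f : 'rV[R[i]]_d,
    A%:C * dotmx f f <= \sum_(i < n) `|dotmx f (Phi i)| ^+ 2 /\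
    \sum_(i < n) `|dotmx f (Phi i)| ^+ 2 <= B%:C * dotmx f f.

Definition is_dual_frame (R : realType) (n d : nat)
    (Phi Psi : {ffun 'I_n -> 'rV[R[i]]_d}) : Prop :=
  is_frame Psi /\ forall f : 'rV[R[i]]_d,
    f = \sum_(i < n) dotmx f (Phi i) *: Psi i /\
    f = \sum_(i < n) dotmx f (Psi i) *: Phi i.

Definition frame_operator (R : realType) (n d : nat)
    (Phi : {ffun 'I_n -> 'rV[R[i]]_d}) (f : 'rV[R[i]]_d) : 'rV[R[i]]_d :=
  \sum_(i < n) dotmx f (Phi i) *: Phi i.

Definition canonical_dual (R : realType) (n d : nat)
    (Phi : {ffun 'I_n -> 'rV[R[i]]_d}) : {ffun 'I_n -> 'rV[R[i]]_d} :=
  [ffun i => Phi i *m invmx (lin1_mx (frame_operator Phi))].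

Definition is_alternate_dual_frame (R : realType) (n d : nat)
    (Phi Psi : {ffun 'I_n -> 'rV[R[i]]_d}) : Prop :=
  is_dual_frame Phi Psi /\ Psi <> canonical_dual Phi.

Definition error_operator (R : realType) (n d : nat)
    (Phi Psi : {ffun 'I_n -> 'rV[R[i]]_d}) (L : {set 'I_n})
    (f : 'rV[R[i]]_d) : 'rV[R[i]]_d :=
  \sum_(i in L) dotmx f (Phi i) *: Psi i.

(* [Normc.normc] is the modulus with values in R, whereas `|l| lies in R[i].
   For d > 0 the set below is finite and nonempty, so the supremum is attained. *)
Definition spectral_radius (R : realType) (d : nat) (T : 'M[R[i]]_d) : R :=
  sup [set Normc.normc l | l in [set l : R[i] | eigenvalue T l]]%classic.

(* The default value 0 is harmless: spectral radii are nonnegative. *)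
Definition rho (R : realType) (n d : nat) (r : nat)
    (Phi Psi : {ffun 'I_n -> 'rV[R[i]]_d}) : R :=
  \big[Num.max/0]_(L : {set 'I_n} | #|L| == r)
    spectral_radius (lin1_mx (error_operator Phi Psi L)).

(* v is the minimum of rho^(r)_{Phi,Psi} over all dual frames Psi of Phi; in
   particular the minimum is required to be attained. *)
Definition is_min_rho (R : realType) (n d : nat) (r : nat)
    (Phi : {ffun 'I_n -> 'rV[R[i]]_d}) (v : R) : Prop :=
  (exists Psi, is_dual_frame Phi Psi /\ rho r Phi Psi = v) /\
  (forall Psi, is_dual_frame Phi Psi -> v <= rho r Phi Psi).

Definition spectrally_optimal1 (R : realType) (n d : nat)
    (Phi Psi : {ffun 'I_n -> 'rV[R[i]]_d}) : Prop :=
  is_dual_frame Phi Psi /\ is_min_rho 1 Phi (rho 1 Phi Psi).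

Definition spectrally_optimal2 (R : realType) (n d : nat)
    (Phi Psi : {ffun 'I_n -> 'rV[R[i]]_d}) : Prop :=
  spectrally_optimal1 Phi Psi /\ is_min_rho 2 Phi (rho 2 Phi Psi).

Definition laplacian (R : realType) (n : nat) (e : rel 'I_n) : 'M[R[i]]_n :=
  diag_mx (\row_i #|[set j | e i j]|%:R) - \matrix_(i, j) (e i j)%:R.

(* [J] consists of the first m columns of the identity, so [J *m diag_mx lam *m
   J^T] is diag(lam_1, ..., lam_m, 0, ..., 0) and [M *m J] is the submatrix M_1
   of M.  [Phi i] is the i-th column of B, written as a row vector. *)
Definition is_LG_frame (R : realType) (n m : nat) (e : rel 'I_n)
    (Phi : {ffun 'I_n -> 'rV[R[i]]_m}) : Prop :=
  (n_comp e 'I_n + m)%N = n /\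
  exists (M : 'M[R[i]]_n) (lam : 'rV[R[i]]_m),
    let J : 'M[R[i]]_(n, m) := pid_mx m in
    let B : 'M[R[i]]_(m, n) :=
      diag_mx (map_mx sqrtC lam) *m (M *m J) ^t* in
    [/\ M \is unitarymx,
        forall j, lam 0 j != 0,
        laplacian R e = M *m (J *m diag_mx lam *m J^T) *m M ^t* &
        forall i, Phi i = (col i B)^T].

(* Main.v *)
(* Let K be the orthogonal projection onto the functions constant on each
   component of G.  The vectors of Phi sum to 0 over each component, and a trace
   count then shows that the canonical dual Psi0 has cross Gram matrix
   Q0 = (<psi_i, phi_j>) = 1 - K.  For an arbitrary dual the defect 1 - Q has
   rows that are equal within a component and that sum to 1 over it; hence the
   diagonal of Q has average 1 - 1/c on a component of size c, and
   psi_i - psi_j is a fixed vector of the error operator on {i, j} when i and j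
   are connected.  So rho^(1) >= 1 - 1/c_max and rho^(2) >= 1.
   The canonical dual attains both bounds, and so does the dual obtained by
   adding psi0_a to every psi0_i with i in a fixed component not containing a:
   this changes Q0 only in an off-diagonal block whose transposed block is 0, so
   the spectra of all blocks on at most two indices are unchanged.  The new dual
   differs from Psi0 as soon as the component of a is not a singleton. *)
From HB Require Import structures.
Require Import Defs.
From mathcomp Require Import all_boot all_order all_algebra.
From mathcomp Require Import sesquilinear spectral complex.
From mathcomp Require Import classical_sets reals.
From mathcomp Require Import ring lra.

Set Implicit Arguments.
Unset Strict Implicit.
Unset Printing Implicit Defensive.

Import Order.TTheory GRing.Theory Num.Theory.
Local Open Scope ring_scope.
Local Open Scope complex_scope.
Local Open Scope sesquilinear_scope.

(** * Frames as matrices, and frame bounds *)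

(** On row vectors, right multiplication by the adjoint of this matrix is the analysis map and by
    the matrix itself the synthesis map, so duality becomes one matrix equation. *)
Definition rows_mx (R : realType) (n d : nat)
    (Phi : {ffun 'I_n -> 'rV[R[i]]_d}) : 'M[R[i]]_(n, d) :=
  \matrix_i Phi i.

Lemma adjmxE (C : numClosedFieldType) (m n : nat) (A : 'M[C]_(m, n)) i j :
  A ^t* i j = Num.conj (A j i).
Proof. by rewrite !mxE. Qed.

Lemma adjmxM (C : numClosedFieldType) (m n p : nat)
    (A : 'M[C]_(m, n)) (B : 'M[C]_(n, p)) :
  (A *m B) ^t* = B ^t* *m A ^t*.
Proof. by rewrite trmx_mul map_mxM. Qed.

Lemma dotmx_mulmx (R : realType) (n d : nat)
    (Phi : {ffun 'I_n -> 'rV[R[i]]_d}) (f : 'rV[R[i]]_d) i :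
  dotmx f (Phi i) = (f *m (rows_mx Phi) ^t*) 0 i.
Proof. by rewrite dotmxE !mxE; apply: eq_bigr => j _; rewrite !mxE. Qed.

Lemma sum_dotmx_scale (R : realType) (n d : nat)
    (Phi Psi : {ffun 'I_n -> 'rV[R[i]]_d}) (f : 'rV[R[i]]_d) :
  \sum_i dotmx f (Phi i) *: Psi i = f *m (rows_mx Phi) ^t* *m rows_mx Psi.
Proof.
rewrite [RHS]mulmx_sum_row; apply: eq_bigr => i _.
by rewrite dotmx_mulmx rowK.
Qed.

Lemma sum_sqr_dotmx (R : realType) (n d : nat)
    (Phi : {ffun 'I_n -> 'rV[R[i]]_d}) (f : 'rV[R[i]]_d) :
  \sum_i `|dotmx f (Phi i)| ^+ 2 =
    dotmx (f *m (rows_mx Phi) ^t*) (f *m (rows_mx Phi) ^t*).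
Proof.
rewrite dotmxE [RHS]mxE; apply: eq_bigr => i _.
by rewrite dotmx_mulmx adjmxE -normCK.
Qed.

Lemma sum_sqr_dotmx_le (R : realType) (n d : nat)
    (Phi : {ffun 'I_n -> 'rV[R[i]]_d}) :
  exists2 B : R, 0 <= B & forall f : 'rV[R[i]]_d,
    \sum_i `|dotmx f (Phi i)| ^+ 2 <= B%:C * dotmx f f.
Proof.
pose b := \sum_i dotmx (Phi i) (Phi i).
have b_ge0 : 0 <= b by apply: sumr_ge0 => i _; apply: dnorm_ge0.
have bE : (complex.Re b)%:C = b by apply/RRe_real/ger0_real.
exists (complex.Re b) => [|f]; first by rewrite -ler0c bE.
rewrite bE /b mulr_suml; apply: ler_sum => i _.
by rewrite mulrC; apply: CauchySchwarz.
Qed.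

(** The upper bound is Cauchy-Schwarz. For the lower one, let x and y be the coefficients of f
    against [Psi] and [Phi]. Duality gives <f,f> = <x,y>, hence |f|^4 <= |x|^2 |y|^2 <= |x|^2 B1
    |f|^2. *)
Lemma dual_mx_is_frame (R : realType) (n d : nat)
    (Phi Psi : {ffun 'I_n -> 'rV[R[i]]_d}) :
  (rows_mx Phi) ^t* *m rows_mx Psi = 1%:M -> is_frame Psi.
Proof.
move=> dualM.
have [B0 B0_ge0 leB] := sum_sqr_dotmx_le Psi.
have [B1 B1_ge0 leB1] := sum_sqr_dotmx_le Phi.
have B1_gt0 : 0 < B1 + 1 by rewrite ltr_wpDl.
(* Adding 1 makes the inverse meaningful even if B1 = 0, and separates the two bounds by the value
   1. *)
exists (B1 + 1)^-1, (B0 + 1); split; first by rewrite invr_gt0.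
split.
  rewrite (@le_trans _ _ 1) ?lerDr //.
  by rewrite invf_le1 // lerDr.
move=> f; split; last first.
  apply: le_trans (leB f) _.
  by rewrite ler_wpM2r ?dnorm_ge0 // lecR lerDl ler01.
have B1C_gt0 : 0 < (B1 + 1)%:C by rewrite ltcR.
rewrite fmorphV ler_pdivrMl //.
have [-> | f_neq0] := eqVneq f 0.
  rewrite linear0l; apply: mulr_ge0; first by rewrite ler0c ltW.
  by apply: sumr_ge0 => i _; rewrite exprn_ge0.
set x := f *m (rows_mx Psi) ^t*.
set y := f *m (rows_mx Phi) ^t*.
have dff : dotmx f f = dotmx x y.
  rewrite !dotmxE /x /y adjmxM trmxCK mulmxA -(mulmxA f).
  have -> : (rows_mx Psi) ^t* *m rows_mx Phi = 1%:M.
    by rewrite -[rows_mx Phi]trmxCK -adjmxM dualM trmx1 map_mx1.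
  by rewrite mulmx1.
have f_gt0 : 0 < dotmx f f by rewrite dnorm_gt0.
have le_xy : `|dotmx x y| ^+ 2 <= dotmx x x * dotmx y y.
  by apply: CauchySchwarz.
rewrite sum_sqr_dotmx -/x -(ler_pM2r f_gt0).
have -> : dotmx f f * dotmx f f = `|dotmx x y| ^+ 2.
  by rewrite -dff ger0_norm ?expr2 // ltW.
apply: le_trans le_xy _; rewrite mulrAC mulrC.
rewrite ler_wpM2r ?dnorm_ge0 //.
have := leB1 f; rewrite sum_sqr_dotmx -/y => /le_trans; apply.
by rewrite ler_wpM2r ?dnorm_ge0 // lecR lerDl ler01.
Qed.

(** * Error operators and blocks of the cross Gram matrix *)

Lemma error_operator_is_linear (R : realType) (n d : nat)
    (Phi Psi : {ffun 'I_n -> 'rV[R[i]]_d}) (L : {set 'I_n}) :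
  linear (error_operator Phi Psi L).
Proof.
move=> a f g; rewrite /error_operator scaler_sumr -big_split /=.
by apply: eq_bigr => i _; rewrite linearPl scalerDl scalerA.
Qed.

HB.instance Definition _ (R : realType) (n d : nat)
    (Phi Psi : {ffun 'I_n -> 'rV[R[i]]_d}) (L : {set 'I_n}) :=
  GRing.isLinear.Build _ _ _ _ (error_operator Phi Psi L)
    (error_operator_is_linear Phi Psi L).

Lemma error_eigenvalueP (R : realType) (n d : nat)
    (Phi Psi : {ffun 'I_n -> 'rV[R[i]]_d}) (L : {set 'I_n}) (l : R[i]) :
  reflect (exists2 f, error_operator Phi Psi L f = l *: f & f != 0)
    (eigenvalue (lin1_mx (error_operator Phi Psi L)) l).
Proof.
apply: (iffP eigenvalueP) => -[f fE f_neq0]; exists f => //.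
  by rewrite -fE mul_rV_lin1.
by rewrite mul_rV_lin1.
Qed.

(** Pairing the eigenvector equation with [Phi j] trades it for one on the block of the cross Gram
    matrix indexed by [L]. *)
Lemma error_eigen_coord (R : realType) (n d : nat)
    (Phi Psi : {ffun 'I_n -> 'rV[R[i]]_d}) (L : {set 'I_n}) (l : R[i]) f :
  error_operator Phi Psi L f = l *: f ->
  forall j, l * dotmx f (Phi j) =
    \sum_(i in L) dotmx f (Phi i) * dotmx (Psi i) (Phi j).
Proof.
move=> fE j; rewrite -[LHS]linearZl_LR -fE linear_sumlz.
by apply: eq_bigr => i _; rewrite linearZl_LR.
Qed.

(** Otherwise the error operator would kill f. So an eigenvector for a nonzero eigenvalue gives a
    nonzero eigenvector of the block. *)
Lemma error_eigen_coord_neq0 (R : realType) (n d : nat)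
    (Phi Psi : {ffun 'I_n -> 'rV[R[i]]_d}) (L : {set 'I_n}) (l : R[i]) f :
    error_operator Phi Psi L f = l *: f -> f != 0 -> l != 0 ->
  exists2 i, i \in L & dotmx f (Phi i) != 0.
Proof.
move=> fE f_neq0 l_neq0; apply/exists_inP; apply: contraT.
rewrite negb_exists_in => /forall_inP f_orth.
have /eqP : l *: f = 0.
  rewrite -fE /error_operator big1 // => i iL.
  by have := f_orth i iL; rewrite negbK => /eqP ->; rewrite scale0r.
by rewrite scaler_eq0 (negPf l_neq0) (negPf f_neq0).
Qed.

(** * Bounds on spectral radii *)

Lemma normc_ge0 (R : rcfType) (z : R[i]) : 0 <= Normc.normc z.
Proof. by rewrite -ler0c -[X in _ <= X]/`|z| normr_ge0. Qed.

Lemma normc_real (R : rcfType) (x : R) : Normc.normc x%:C = `|x|.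
Proof. by rewrite /Normc.normc /= expr0n /= addr0 sqrtr_sqr. Qed.

Lemma normc_sum (R : rcfType) (I : finType) (P : pred I) (F : I -> R[i]) :
  Normc.normc (\sum_(i | P i) F i) <= \sum_(i | P i) Normc.normc (F i).
Proof.
by rewrite -lecR raddf_sum; apply: (ler_norm_sum _ F).
Qed.

(** The supremum is an upper bound only once the set is known to be bounded. Eigenvalues are roots
    of the characteristic polynomial, so the sum of the moduli of all roots bounds them. *)
Lemma normc_le_spectral_radius (R : realType) (d : nat) (T : 'M[R[i]]_d) l :
  eigenvalue T l -> Normc.normc l <= spectral_radius T.
Proof.
move=> Tl; apply: ub_le_sup; last by exists l.
have [rs char_polyE] := closed_field_poly_normal (char_poly T).
exists (\sum_(z <- rs) Normc.normc z) => _ [z /= Tz <-].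
have z_rs : z \in rs.
  move: Tz; rewrite eigenvalue_root_char char_polyE (monicP (char_poly_monic T)).
  by rewrite scale1r root_prod_XsubC.
rewrite (perm_big _ (perm_to_rem z_rs)) big_cons lerDl.
by apply: sumr_ge0 => w _; apply: normc_ge0.
Qed.

Lemma spectral_radius_le (R : realType) (d : nat) (T : 'M[R[i]]_d) (x : R) :
    0 <= x -> (forall l, eigenvalue T l -> Normc.normc l <= x) ->
  spectral_radius T <= x.
Proof.
move=> x_ge0 le_x; rewrite /spectral_radius; set S := image _ _.
(* Without eigenvalues, as for d = 0, [sup] takes its default value 0. *)
have [-> | /set0P S_neq0] := eqVneq S set0; first by rewrite sup0.
by apply: ge_sup => // _ [l /= Tl <-]; apply: le_x.
Qed.

Lemma normc_le_rho (R : realType) (n d r : nat) (L : {set 'I_n})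
    (Phi Psi : {ffun 'I_n -> 'rV[R[i]]_d}) l f :
    #|L| = r -> error_operator Phi Psi L f = l *: f -> f != 0 ->
  Normc.normc l <= rho r Phi Psi.
Proof.
move=> cardL fE f_neq0; apply: le_trans (normc_le_spectral_radius _) _; last first.
  by apply: (@le_bigmax_cond _ _ _ _ L); apply/eqP.
by apply/error_eigenvalueP; exists f.
Qed.

Lemma rho_le (R : realType) (n d r : nat)
    (Phi Psi : {ffun 'I_n -> 'rV[R[i]]_d}) (x : R) :
    0 <= x ->
    (forall (L : {set 'I_n}) l f, #|L| = r -> l != 0 -> f != 0 ->
      error_operator Phi Psi L f = l *: f -> Normc.normc l <= x) ->
  rho r Phi Psi <= x.
Proof.
move=> x_ge0 le_x; apply: bigmax_le => // L /eqP cardL.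
apply: spectral_radius_le => // l /error_eigenvalueP[f fE f_neq0].
have [-> | l_neq0] := eqVneq l 0; first by rewrite Normc.normc0.
exact: (le_x L l f).
Qed.

Lemma rho_ge0 (R : realType) (n d r : nat)
    (Phi Psi : {ffun 'I_n -> 'rV[R[i]]_d}) :
  0 <= rho r Phi Psi.
Proof. exact: bigmax_ge_id. Qed.

(** * Orthogonal projections and averaging over components *)

(** Each diagonal entry is the sum of the squared moduli of its row. These are nonnegative with sum
    0, so every entry vanishes. *)
Lemma hermitian_idem_tr0 (C : numClosedFieldType) (n : nat) (A : 'M[C]_n) :
  A ^t* = A -> A *m A = A -> \tr A = 0 -> A = 0.
Proof.
move=> herA idA trA.
have AE i : A i i = \sum_j `|A i j| ^+ 2.
  rewrite -{1}idA mxE; apply: eq_bigr => j _.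
  by rewrite normCK -adjmxE herA.
have A_ge0 i : 0 <= A i i by rewrite AE sumr_ge0 // => j _; rewrite exprn_ge0.
apply/matrixP => i j; rewrite mxE.
have /eqP Aii : A i i == 0.
  by apply/eqP; apply: (psumr_eq0P _ trA) => // k _.
have /eqP : `|A i j| ^+ 2 = 0.
  apply: (psumr_eq0P (P := xpredT) (F := fun j => `|A i j| ^+ 2)) => //.
    by move=> k _; rewrite exprn_ge0.
  by rewrite -AE.
by rewrite sqrf_eq0 normr_eq0 => /eqP.
Qed.

(** The fibers of [rt] stand for the components; [rt] will be the map sending a vertex to the root
    of its component. *)
Definition block_size (n : nat) (rt : 'I_n -> 'I_n) (i : 'I_n) : nat :=
  #|[pred j | rt j == rt i]|.

(* The orthogonal projection onto the vectors that are constant on the fibers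
   of [rt]. *)
Definition block_avg (C : numClosedFieldType) (n : nat) (rt : 'I_n -> 'I_n) :
    'M[C]_n :=
  \matrix_(i, j) if rt j == rt i then (block_size rt i)%:R^-1 else 0.

Lemma block_size_gt0 (n : nat) (rt : 'I_n -> 'I_n) i : (0 < block_size rt i)%N.
Proof. by apply/card_gt0P; exists i; rewrite inE. Qed.

Lemma block_size_neq0 (C : numClosedFieldType) (n : nat) (rt : 'I_n -> 'I_n) i :
  (block_size rt i)%:R != 0 :> C.
Proof. by rewrite pnatr_eq0 -lt0n block_size_gt0. Qed.

Lemma eq_block_size (n : nat) (rt : 'I_n -> 'I_n) i j :
  rt i = rt j -> block_size rt i = block_size rt j.
Proof. by rewrite /block_size => ->. Qed.

Lemma block_size_gt1 (n : nat) (rt : 'I_n -> 'I_n) i j :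
  i != j -> rt i = rt j -> (1 < block_size rt i)%N.
Proof.
move=> ij rt_ij; rewrite /block_size (cardD1 i) (cardD1 j) !inE eqxx rt_ij.
by rewrite eqxx eq_sym ij.
Qed.

Lemma tr_block_avg (C : numClosedFieldType) (n : nat) (rt : 'I_n -> 'I_n) :
  (block_avg C rt)^T = block_avg C rt.
Proof.
apply/matrixP => i j; rewrite !mxE eq_sym.
by case: eqP => // /eq_block_size ->.
Qed.

Lemma adjmx_block_avg (C : numClosedFieldType) (n : nat) (rt : 'I_n -> 'I_n) :
  (block_avg C rt) ^t* = block_avg C rt.
Proof.
rewrite tr_block_avg; apply/matrixP => i j; rewrite !mxE.
by case: ifP => _; rewrite ?rmorph0 // fmorphV rmorph_nat.
Qed.

Lemma mul_block_avg (C : numClosedFieldType) (n p : nat) (rt : 'I_n -> 'I_n)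
    (A : 'M[C]_(n, p)) i j :
  (block_avg C rt *m A) i j =
    (block_size rt i)%:R^-1 * \sum_(k | rt k == rt i) A k j.
Proof.
rewrite mxE mulr_sumr [RHS]big_mkcond; apply: eq_bigr => k _ /=.
by rewrite mxE; case: ifP => // _; rewrite mul0r.
Qed.

Lemma block_avg_eq_row (C : numClosedFieldType) (n p : nat) (rt : 'I_n -> 'I_n)
    (A : 'M[C]_(n, p)) i i' j :
  block_avg C rt *m A = A -> rt i = rt i' -> A i j = A i' j.
Proof.
by move=> <- rt_ii'; rewrite !mul_block_avg rt_ii' (eq_block_size rt_ii').
Qed.

Lemma block_avg_fix (C : numClosedFieldType) (n p : nat) (rt : 'I_n -> 'I_n)
    (A : 'M[C]_(n, p)) :
  (forall i i' j, rt i = rt i' -> A i j = A i' j) -> block_avg C rt *m A = A.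
Proof.
move=> constA; apply/matrixP => i j; rewrite mul_block_avg.
rewrite (eq_bigr (fun=> A i j)) => [|k /eqP rt_k]; last exact: constA.
by rewrite sumr_const -[A i j *+ _]mulr_natl mulKf // block_size_neq0.
Qed.

Lemma block_avg_idem (C : numClosedFieldType) (n : nat) (rt : 'I_n -> 'I_n) :
  block_avg C rt *m block_avg C rt = block_avg C rt.
Proof.
by apply: block_avg_fix => i i' j rt_ii'; rewrite !mxE rt_ii' (eq_block_size rt_ii').
Qed.

(** A fiber of size c contributes c times 1/c, and by idempotence of [rt] the fibers correspond to
    its fixed points. *)
Lemma mxtrace_block_avg (C : numClosedFieldType) (n : nat) (rt : 'I_n -> 'I_n) :
    (forall i, rt (rt i) = rt i) ->
  \tr (block_avg C rt) = #|[pred i | rt i == i]|%:R.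
Proof.
move=> rtK; rewrite /mxtrace.
rewrite (partition_big rt [pred i | rt i == i]) /=; last by move=> i _; rewrite rtK.
rewrite (eq_bigr (fun=> 1)) ?sumr_const // => r /eqP rtr.
rewrite (eq_bigr (fun=> (block_size rt r)%:R^-1)) => [|i /eqP rti]; last first.
  by rewrite mxE eqxx (@eq_block_size _ _ i r) // rti rtr.
rewrite sumr_const -[LHS]mulr_natl.
have -> : #|[pred i | rt i == r]| = block_size rt r.
  by apply: eq_card => i; rewrite !inE rtr.
by rewrite mulfV // block_size_neq0.
Qed.

(** The left side P is the orthogonal projection onto the column space of F, of trace d, and K is
    one orthogonal to it. Hence 1 - (P + K) is a Hermitian idempotent, of trace 0 by the dimension
    count. *)
Lemma gram_proj (C : numClosedFieldType) (n d : nat) (rt : 'I_n -> 'I_n)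
    (F : 'M[C]_(n, d)) :
    (forall i, rt (rt i) = rt i) -> (#|[pred i | rt i == i]| + d)%N = n ->
    F ^t* *m F \in unitmx -> block_avg C rt *m F = 0 ->
  F *m invmx (F ^t* *m F) *m F ^t* = 1%:M - block_avg C rt.
Proof.
move=> rtK card_rt unitG KF.
set P := _ *m F ^t*; set K := block_avg C rt.
have adjK : K ^t* = K by apply: adjmx_block_avg.
have adjP : P ^t* = P.
  rewrite /P !adjmxM trmxCK mulmxA; congr (_ *m _ *m _).
  rewrite trmx_inv map_invmx; congr invmx.
  by rewrite adjmxM trmxCK.
have PP : P *m P = P.
  by rewrite /P -!mulmxA (mulmxA (F ^t*)) (mulmxA (invmx _)) mulVmx // mul1mx.
have KP : K *m P = 0 by rewrite /P !mulmxA KF !mul0mx.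
have PK : P *m K = 0.
  by rewrite -adjP -{1}adjK -adjmxM KP trmx0 map_mx0.
suff /subr0_eq -> : 1%:M - (P + K) = 0 by rewrite addrK.
have adjB (A B : 'M[C]_n) : (A - B) ^t* = A ^t* - B ^t*.
  by apply/matrixP => i j; rewrite !mxE rmorphB.
have adjD (A B : 'M[C]_n) : (A + B) ^t* = A ^t* + B ^t*.
  by apply/matrixP => i j; rewrite !mxE rmorphD.
apply: hermitian_idem_tr0.
- by rewrite adjB adjD trmx1 map_mx1 adjP adjK.
- rewrite mulmxBl mul1mx mulmxBr mulmx1 mulmxDl !mulmxDr PP KP PK.
  by rewrite /K block_avg_idem -/K addr0 add0r subrr subr0.
- rewrite linearB linearD /= mxtrace1 /P mxtrace_mulC mulmxA mulmxV // mxtrace1.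
  by rewrite mxtrace_block_avg // -natrD addnC card_rt subrr.
Qed.

(** * Duality in matrix form, and eigenvalues of two-by-two blocks *)

(** The two reconstruction formulas are adjoint to each other, and the frame bounds come for free
    from [dual_mx_is_frame]. *)
Lemma dual_frame_mxP (R : realType) (n d : nat)
    (Phi Psi : {ffun 'I_n -> 'rV[R[i]]_d}) :
  is_dual_frame Phi Psi <-> (rows_mx Phi) ^t* *m rows_mx Psi = 1%:M.
Proof.
split=> [[_ dualE] | dualM].
  apply/row_matrixP => i; rewrite !rowE mulmx1 mulmxA -sum_dotmx_scale.
  by have [<- _] := dualE 'e_i.
split; first exact: (dual_mx_is_frame dualM).
move=> f; rewrite !sum_dotmx_scale -!mulmxA dualM; split; first by rewrite mulmx1.
by rewrite -[rows_mx Phi]trmxCK -adjmxM dualM trmx1 map_mx1 mulmx1.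
Qed.

Lemma dotmx_cross (R : realType) (n d : nat)
    (Phi Psi : {ffun 'I_n -> 'rV[R[i]]_d}) i j :
  dotmx (Psi i) (Phi j) = (rows_mx Psi *m (rows_mx Phi) ^t*) i j.
Proof.
by rewrite dotmx_mulmx !mxE; apply: eq_bigr => k _; rewrite !mxE.
Qed.

Lemma mul_adj_block_avg (R : realType) (n d : nat) (rt : 'I_n -> 'I_n)
    (F : 'M[R[i]]_(n, d)) :
  block_avg _ rt *m F = 0 -> F ^t* *m block_avg _ rt = 0.
Proof.
by move=> KF; rewrite -adjmx_block_avg -adjmxM KF trmx0 map_mx0.
Qed.

Lemma dotmxBl (C : numClosedFieldType) (d : nat) (u v w : 'rV[C]_d) :
  dotmx (u - v) w = dotmx u w - dotmx v w.
Proof. by rewrite linearBl. Qed.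

Lemma sum_set2 (T : finType) (V : nmodType) (F : T -> V) (x y : T) :
  x != y -> \sum_(z in [set x; y]) F z = F x + F y.
Proof. by move=> xy; rewrite big_setU1 ?inE // big_set1. Qed.

Lemma error_eigen_pair (R : realType) (n d : nat)
    (Phi Psi : {ffun 'I_n -> 'rV[R[i]]_d}) (i j : 'I_n) (l : R[i]) f :
    i != j -> error_operator Phi Psi [set i; j] f = l *: f ->
    f != 0 -> l != 0 ->
  exists x y : R[i], [/\ (x != 0) || (y != 0),
    l * x = x * dotmx (Psi i) (Phi i) + y * dotmx (Psi j) (Phi i) &
    l * y = x * dotmx (Psi i) (Phi j) + y * dotmx (Psi j) (Phi j)].
Proof.
move=> ij fE f_neq0 l_neq0; exists (dotmx f (Phi i)), (dotmx f (Phi j)).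
split; try by rewrite (error_eigen_coord fE) sum_set2.
have [k /set2P[] -> fk_neq0] := error_eigen_coord_neq0 fE f_neq0 l_neq0.
  by apply/orP; left.
by apply/orP; right.
Qed.

Lemma triangular_pair_eigenvalue (C : fieldType) (l x y a b c e : C) :
    (x != 0) || (y != 0) -> l * x = x * a + y * b -> l * y = x * c + y * e ->
    b = 0 \/ c = 0 ->
  l = a \/ l = e.
Proof.
move=> xy_neq0 eq_x eq_y bc0.
have [x0 | x_neq0] := eqVneq x 0.
  have y_neq0 : y != 0 by move: xy_neq0; rewrite x0 eqxx.
  by right; apply: (mulIf y_neq0); rewrite eq_y x0 mul0r add0r mulrC.
have [y0 | y_neq0] := eqVneq y 0.
  by left; apply: (mulIf x_neq0); rewrite eq_x y0 mul0r addr0 mulrC.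
case: bc0 => [b0 | c0]; [left | right].
  by apply: (mulIf x_neq0); rewrite eq_x b0 mulr0 addr0 mulrC.
by apply: (mulIf y_neq0); rewrite eq_y c0 mulr0 add0r mulrC.
Qed.

(** The block is the identity minus s times the all-ones matrix: (1, -1) has eigenvalue 1 and (1, 1)
    has 1 - 2s. The proof splits on whether x + y vanishes. *)
Lemma constant_pair_eigenvalue (C : fieldType) (l x y s : C) :
    (x != 0) || (y != 0) -> l * x = x * (1 - s) + y * (0 - s) ->
    l * y = x * (0 - s) + y * (1 - s) ->
  l = 1 \/ l = 1 - s - s.
Proof.
move=> xy_neq0 eq_x eq_y.
have [xy0 | xy_neq] := eqVneq (x + y) 0.
  have y_eq : y = - x by apply/eqP; rewrite -addr_eq0 addrC xy0.
  have x_neq0 : x != 0 by move: xy_neq0; rewrite y_eq oppr_eq0 orbb.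
  by left; apply: (mulIf x_neq0); rewrite eq_x y_eq; ring.
by right; apply: (mulIf xy_neq); rewrite mulrDr eq_x eq_y; ring.
Qed.

(** * Lower bounds for every dual, upper bounds for block triangular ones *)

Section BalancedFrame.

(* The Gram matrix of [Phi] has the kernel of the Laplacian of a graph whose
   components are the fibers of [rt]. *)
Variables (R : realType) (n d : nat) (rt : 'I_n -> 'I_n).
Variable Phi : {ffun 'I_n -> 'rV[R[i]]_d}.
Hypothesis KPhi : block_avg _ rt *m rows_mx Phi = 0.
Hypothesis projPhi :
  rows_mx Phi *m invmx ((rows_mx Phi) ^t* *m rows_mx Phi) *m (rows_mx Phi) ^t* =
    1%:M - block_avg _ rt.

Let F := rows_mx Phi.
Let K : 'M[R[i]]_n := block_avg _ rt.
Let size_inv i : R := (block_size rt i)%:R^-1.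

Lemma size_inv_ge0 i : 0 <= size_inv i.
Proof. by rewrite invr_ge0 ler0n. Qed.

Lemma size_inv_le1 i : size_inv i <= 1.
Proof. by rewrite invf_le1 ?ler1n ?ltr0n block_size_gt0. Qed.

(** By duality [F ^t*] annihilates the defect, hence so does 1 - K, which factors through [F ^t*] by
    [projPhi]. *)
Lemma dual_defect_cols Psi : is_dual_frame Phi Psi ->
  K *m (1%:M - rows_mx Psi *m F ^t*) = 1%:M - rows_mx Psi *m F ^t*.
Proof.
move=> /dual_frame_mxP dualM; set N := 1%:M - _.
apply/esym/subr0_eq; rewrite -{1}[N]mul1mx -mulmxBl -projPhi -!mulmxA.
have -> : (rows_mx Phi) ^t* *m N = 0.
  by rewrite mulmxBr mulmx1 mulmxA dualM mul1mx subrr.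
by rewrite !mulmx0.
Qed.

Lemma dual_defectE Psi i j :
  (1%:M - rows_mx Psi *m F ^t*) i j = (i == j)%:R - dotmx (Psi i) (Phi j).
Proof. by rewrite dotmx_cross [LHS]mxE [X in X + _]mxE [X in _ + X]mxE. Qed.

Lemma dual_defect_eq_row Psi i i' j : is_dual_frame Phi Psi -> rt i = rt i' ->
  (i == j)%:R - dotmx (Psi i) (Phi j) = (i' == j)%:R - dotmx (Psi i') (Phi j).
Proof.
move=> dual_Psi rt_ii'.
have := block_avg_eq_row j (dual_defect_cols dual_Psi) rt_ii'.
by rewrite !dual_defectE.
Qed.

(** Since [F ^t*] annihilates K, the defect times K equals K; the claim is the diagonal entry at i,
    multiplied by the size of the fiber. *)
Lemma dual_defect_sum Psi i : is_dual_frame Phi Psi ->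
  \sum_(j | rt j == rt i) ((i == j)%:R - dotmx (Psi i) (Phi j)) = 1.
Proof.
move=> dual_Psi.
have : ((1%:M - rows_mx Psi *m F ^t*) *m K) i i = (block_size rt i)%:R^-1.
  rewrite mulmxBl mul1mx -mulmxA /F /K mul_adj_block_avg // mulmx0 subr0.
  by rewrite mxE eqxx.
rewrite mxE => sumE; apply: (mulIf (invr_neq0 (block_size_neq0 _ rt i))).
rewrite mul1r -[RHS]sumE mulr_suml big_mkcond; apply: eq_bigr => j _ /=.
rewrite [K j i]mxE [rt i == _]eq_sym; case: eqP => [rt_ji | _]; last by rewrite mulr0.
rewrite (eq_block_size rt_ji); congr (_ * _).
by rewrite dual_defectE.
Qed.

(** Rows of the defect agree within a fiber, so its diagonal there sums to the row sum 1 and the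
    diagonal of the cross Gram matrix to c - 1. By the triangle inequality, the entry of largest
    modulus is at least (c - 1)/c. *)
Lemma dual_diag_large Psi i0 : is_dual_frame Phi Psi ->
  exists i, 1 - size_inv i0 <= Normc.normc (dotmx (Psi i) (Phi i)).
Proof.
move=> dual_Psi; set c := block_size rt i0.
have c_gt0 : 0 < c%:R :> R by rewrite ltr0n block_size_gt0.
have sumE : \sum_(i | rt i == rt i0) dotmx (Psi i) (Phi i) = (c%:R - 1)%:C.
  have : \sum_(i | rt i == rt i0) (1 - dotmx (Psi i) (Phi i)) = 1.
    rewrite -[RHS](dual_defect_sum i0 dual_Psi); apply: eq_bigr => i /eqP rt_i.
    by rewrite -(dual_defect_eq_row _ dual_Psi rt_i) eqxx.
  rewrite sumrB sumr_const => defect_sum.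
  by rewrite rmorphB rmorph_nat rmorph1; apply: (canRL (subKr _) defect_sum).
pose nQ i := Normc.normc (dotmx (Psi i) (Phi i)).
have [i rt_i max_i] := @arg_maxP _ _ _ i0 (fun i => rt i == rt i0) nQ (eqxx _).
exists i; rewrite -(ler_pM2r c_gt0) mulrBl mul1r mulVf ?lt0r_neq0 //.
have c_ge1 : 0 <= c%:R - 1 :> R by rewrite subr_ge0 ler1n block_size_gt0.
rewrite -(ger0_norm c_ge1) -normc_real -sumE; apply: le_trans (normc_sum _ _) _.
by rewrite mulr_natr -sumr_const; apply: ler_sum.
Qed.

(** Comparing rows i and j of the defect at columns i and j shows that the difference has
    coefficients 1 and -1 there, so the error operator reproduces it. *)
Lemma dual_pair_eigen Psi i j :
    is_dual_frame Phi Psi -> i != j -> rt i = rt j ->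
  error_operator Phi Psi [set i; j] (Psi i - Psi j) = Psi i - Psi j /\
  Psi i - Psi j != 0.
Proof.
move=> dual_Psi ij rt_ij.
have dot_i : dotmx (Psi i - Psi j) (Phi i) = 1.
  have := dual_defect_eq_row i dual_Psi rt_ij.
  rewrite eqxx eq_sym (negPf ij) sub0r => defect_i.
  by rewrite dotmxBl -defect_i addrC subrK.
have dot_j : dotmx (Psi i - Psi j) (Phi j) = -1.
  have := dual_defect_eq_row j dual_Psi rt_ij.
  rewrite eqxx (negPf ij) sub0r => defect_j.
  have dot_ij : dotmx (Psi i) (Phi j) = dotmx (Psi j) (Phi j) - 1.
    by rewrite -[LHS]opprK defect_j opprB.
  by rewrite dotmxBl dot_ij addrAC subrr sub0r.
split.
  rewrite /error_operator sum_set2 // dot_i dot_j.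
  by rewrite scale1r scaleN1r.
apply: contra_eq_neq dot_i => ->.
by rewrite linear0l eq_sym oner_neq0.
Qed.

Lemma rho1_dual_ge Psi i0 :
  is_dual_frame Phi Psi -> 1 - size_inv i0 <= rho 1 Phi Psi.
Proof.
move=> dual_Psi; have [i le_i] := dual_diag_large i0 dual_Psi.
apply: le_trans le_i _.
(* A nonzero [Psi i] is itself an eigenvector of the error operator on {i}; if it is zero, the
   diagonal entry is 0. *)
have [Psi0 | Psi_neq0] := eqVneq (Psi i) 0.
  by rewrite Psi0 linear0l Normc.normc0 rho_ge0.
apply: (normc_le_rho (cards1 i) (f := Psi i)) => //.
by rewrite /error_operator big_set1.
Qed.

Lemma rho2_dual_ge Psi i j :
  is_dual_frame Phi Psi -> i != j -> rt i = rt j -> 1 <= rho 2 Phi Psi.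
Proof.
move=> dual_Psi ij rt_ij; have [fE f_neq0] := dual_pair_eigen dual_Psi ij rt_ij.
have card2 : #|[set i; j]| = 2%N by rewrite cards2 ij.
rewrite -(Normc.normc1 R).
by apply: (normc_le_rho card2 _ f_neq0); rewrite scale1r.
Qed.

(* For such duals every one- or two-element block of the cross Gram matrix has
   the same spectrum as for the canonical dual. *)
Definition block_triangular_dual (Psi : {ffun 'I_n -> 'rV[R[i]]_d}) :=
  (forall i j, rt i = rt j ->
    dotmx (Psi i) (Phi j) = (i == j)%:R - (size_inv i)%:C) /\
  (forall i j, rt i != rt j ->
    dotmx (Psi i) (Phi j) = 0 \/ dotmx (Psi j) (Phi i) = 0).

Lemma normc_one_sub_size_inv i :
  Normc.normc (1 - (size_inv i)%:C) = 1 - size_inv i.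
Proof.
by rewrite -(rmorphB _ 1) normc_real ger0_norm // subr_ge0 size_inv_le1.
Qed.

(** One-element blocks are the numbers 1 - 1/c, largest on the largest fiber. *)
Lemma rho1_block_triangular Psi i0 :
    block_triangular_dual Psi ->
    (forall i, (block_size rt i <= block_size rt i0)%N) ->
  rho 1 Phi Psi <= 1 - size_inv i0.
Proof.
move=> [diagE _] max_i0.
apply: rho_le => [|L l f /eqP/cards1P[i ->] l_neq0 f_neq0 fE].
  by rewrite subr_ge0 size_inv_le1.
have [i' /set1P-> fi_neq0] := error_eigen_coord_neq0 fE f_neq0 l_neq0.
have := error_eigen_coord fE i; rewrite big_set1 mulrC => /(mulfI fi_neq0) ->.
rewrite diagE // eqxx normc_one_sub_size_inv lerD2l lerN2.
by rewrite lef_pV2 ?posrE ?ltr0n ?block_size_gt0 // ler_nat.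
Qed.

(** Across two fibers the block is triangular with diagonal entries of the form 1 - 1/c. Within a
    fiber its eigenvalues are 1 and 1 - 2/c, and the latter lies in [-1, 1]. *)
Lemma rho2_block_triangular Psi :
  block_triangular_dual Psi -> rho 2 Phi Psi <= 1.
Proof.
move=> [diagE offE].
have one_sub_le1 i : Normc.normc (1 - (size_inv i)%:C) <= 1.
  by rewrite normc_one_sub_size_inv gerBl size_inv_ge0.
apply: rho_le => // L l f /eqP/cards2P[i [j [ij ->]]] l_neq0 f_neq0 fE.
have [x [y [xy_neq0 eq_x eq_y]]] := error_eigen_pair ij fE f_neq0 l_neq0.
have Qii := diagE i i erefl; have Qjj := diagE j j erefl.
rewrite !eqxx in Qii Qjj.
have [rt_ij | rt_ij] := eqVneq (rt i) (rt j); last first.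
  have [|->|->] := triangular_pair_eigenvalue xy_neq0 eq_x eq_y.
  - by case: (offE i j rt_ij); [right | left].
  - by rewrite Qii.
  - by rewrite Qjj.
have size_ij : size_inv j = size_inv i by rewrite /size_inv (eq_block_size rt_ij).
have Qij := diagE i j rt_ij; have Qji := diagE j i (esym rt_ij).
rewrite (negPf ij) in Qij; rewrite eq_sym (negPf ij) size_ij in Qji.
rewrite size_ij in Qjj; rewrite Qii Qji in eq_x; rewrite Qij Qjj in eq_y.
have [-> | ->] := constant_pair_eigenvalue xy_neq0 eq_x eq_y.
  by rewrite Normc.normc1.
have : 0 <= size_inv i <= 1 by rewrite size_inv_ge0 size_inv_le1.
rewrite -(rmorphB _ 1) -rmorphB normc_real => /andP[s_ge0 s_le1].
by rewrite ler_norml; apply/andP; split; lra.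
Qed.

End BalancedFrame.

(** * The canonical dual and its modification on one component *)

Lemma rows_canonical_dual (R : realType) (n d : nat)
    (Phi : {ffun 'I_n -> 'rV[R[i]]_d}) :
  rows_mx (canonical_dual Phi) =
    rows_mx Phi *m invmx ((rows_mx Phi) ^t* *m rows_mx Phi).
Proof.
have -> : (rows_mx Phi) ^t* *m rows_mx Phi = lin1_mx (frame_operator Phi).
  apply/row_matrixP => i; apply/rowP => j.
  by rewrite rowE mulmxA -sum_dotmx_scale !mxE.
by apply/row_matrixP => i; rewrite row_mul !rowK ffunE.
Qed.

Section ModifiedDual.

Variables (R : realType) (n d : nat) (rt : 'I_n -> 'I_n).
Variable Phi : {ffun 'I_n -> 'rV[R[i]]_d}.
Hypothesis KPhi : block_avg _ rt *m rows_mx Phi = 0.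
Hypothesis projPhi :
  rows_mx Phi *m invmx ((rows_mx Phi) ^t* *m rows_mx Phi) *m (rows_mx Phi) ^t* =
    1%:M - block_avg _ rt.
Hypothesis unitPhi : (rows_mx Phi) ^t* *m rows_mx Phi \in unitmx.

Definition modified_dual (i0 a : 'I_n) : {ffun 'I_n -> 'rV[R[i]]_d} :=
  [ffun i => canonical_dual Phi i +
             (rt i == rt i0)%:R *: canonical_dual Phi a].

Lemma canonical_dual_cross i j :
  dotmx (canonical_dual Phi i) (Phi j) =
    (i == j)%:R - block_avg R[i] rt i j.
Proof.
rewrite dotmx_cross rows_canonical_dual projPhi.
by rewrite [LHS]mxE [X in X + _]mxE [X in _ + X]mxE.
Qed.

Lemma modified_dual_cross i0 a i j :
  dotmx (modified_dual i0 a i) (Phi j) =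
    (i == j)%:R - block_avg R[i] rt i j +
    (rt i == rt i0)%:R * ((a == j)%:R - block_avg R[i] rt a j).
Proof.
rewrite -!canonical_dual_cross ffunE addrC [dotmx _ _]linearPl.
by rewrite addrC.
Qed.

(** The matrix changes by a column u times a row, where u is the indicator of a fiber. As u = K u
    and the adjoint of [rows_mx Phi] annihilates K, the product with that adjoint is unchanged. *)
Lemma modified_dual_is_dual i0 a : is_dual_frame Phi (modified_dual i0 a).
Proof.
apply/dual_frame_mxP.
pose u : 'cV[R[i]]_n := \col_i (rt i == rt i0)%:R.
have -> : rows_mx (modified_dual i0 a) =
    rows_mx (canonical_dual Phi) + u *m row a (rows_mx (canonical_dual Phi)).
  apply/row_matrixP => i; rewrite rowK ffunE linearD /= row_mul !rowK.
  congr (_ + _); apply/rowP => j.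
  by rewrite mxE [RHS]mxE big_ord1 !mxE.
have Ku : block_avg _ rt *m u = u.
  by apply: block_avg_fix => i i' j rt_ii'; rewrite !mxE rt_ii'.
rewrite mulmxDr rows_canonical_dual mulmxA mulmxV // mulmxA -Ku.
by rewrite [(rows_mx Phi) ^t* *m _]mulmxA mul_adj_block_avg // !mul0mx addr0.
Qed.

(** The correction, on rows in the fiber of [i0], is row a of the canonical cross Gram matrix,
    supported on the other fiber of a; diagonal blocks are thus untouched. Of two indices in
    different fibers, one has an unmodified row. *)
Lemma modified_dual_block_triangular i0 a :
  rt a != rt i0 -> block_triangular_dual rt Phi (modified_dual i0 a).
Proof.
move=> rt_a; split=> i j.
  move=> rt_ij; rewrite modified_dual_cross.
  have -> : block_avg R[i] rt i j = ((block_size rt i)%:R^-1)%:C.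
    by rewrite mxE rt_ij eqxx fmorphV rmorph_nat.
  have [rt_i | _] := eqVneq (rt i) (rt i0); last by rewrite mul0r addr0.
  have aj : a != j by apply: contraNneq rt_a => ->; rewrite -rt_ij rt_i.
  rewrite mxE -rt_ij rt_i [rt i0 == _]eq_sym (negPf rt_a) (negPf aj).
  by rewrite subr0 mulr0 addr0.
move=> rt_ij.
have off k l : rt k != rt l -> (k == l)%:R - block_avg R[i] rt k l = 0.
  move=> rt_kl; have kl : k != l by apply: contraNneq rt_kl => ->.
  by rewrite mxE [rt l == _]eq_sym (negPf rt_kl) (negPf kl) subr0.
have [rt_i | rt_i] := eqVneq (rt i) (rt i0); [right | left].
  have rt_j : rt j != rt i0 by rewrite -rt_i eq_sym.
  by rewrite modified_dual_cross (negPf rt_j) mul0r addr0 off // eq_sym.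
by rewrite modified_dual_cross (negPf rt_i) mul0r addr0 off.
Qed.

(** At entry (i0, a) the correction is 1 - 1/c with c the size of the fiber of a, and b forces c >
    1. *)
Lemma modified_dual_neq_canonical i0 a b :
  a != b -> rt a = rt b -> modified_dual i0 a <> canonical_dual Phi.
Proof.
move=> ab rt_ab /(congr1 (fun Psi : {ffun _ -> _} => dotmx (Psi i0) (Phi a))).
rewrite modified_dual_cross canonical_dual_cross eqxx mul1r.
rewrite -[RHS]addr0 => /addrI/eqP.
rewrite eqxx mxE eqxx subr_eq0 eq_sym invr_eq1 pnatr_eq1 => /eqP size1.
by have := block_size_gt1 ab rt_ab; rewrite size1.
Qed.

Lemma modified_dual_optimal i0 a b :
    a != b -> rt a = rt b -> rt a != rt i0 ->
  spectrally_optimal2 Phi (modified_dual i0 a).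
Proof.
move=> ab rt_ab rt_a; set Psi := modified_dual i0 a.
have dual_Psi : is_dual_frame Phi Psi by apply: modified_dual_is_dual.
have tri_Psi := modified_dual_block_triangular rt_a.
have [i1 _ max_i1] := arg_maxnP (block_size rt) (erefl (xpredT a)).
(* An upper bound at [Psi] matching a lower bound for all duals yields the minimum. It is used with
   v = 1 - 1/c_max for r = 1 and v = 1 for r = 2. *)
have min_rho r v : rho r Phi Psi <= v ->
    (forall Psi', is_dual_frame Phi Psi' -> v <= rho r Phi Psi') ->
  is_min_rho r Phi (rho r Phi Psi).
  move=> le_v ge_v; split; first by exists Psi.
  by move=> Psi' /ge_v; apply: le_trans.
split; [split; first exact: dual_Psi |].
  apply: (min_rho _ _ (rho1_block_triangular tri_Psi _)).
    by move=> i; apply: max_i1.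
  by move=> Psi'; apply: (rho1_dual_ge KPhi projPhi).
apply: (min_rho _ _ (rho2_block_triangular tri_Psi)) => Psi' dual_Psi'.
exact: (rho2_dual_ge projPhi dual_Psi' ab).
Qed.

End ModifiedDual.

(** * Laplacians and graph frames *)

(** Columns of K are constant along edges, so the degree term and the sum over neighbours cancel. *)
Lemma laplacian_mul_block_avg (R : realType) (n : nat) (e : rel 'I_n)
    (rt : 'I_n -> 'I_n) :
    (forall i j, e i j -> rt i = rt j) ->
  laplacian R e *m block_avg _ rt = 0.
Proof.
move=> e_rt; rewrite /laplacian mulmxBl; apply/eqP; rewrite subr_eq0; apply/eqP.
apply/matrixP => i l; rewrite mul_diag_mx mxE [X in X * _]mxE.
rewrite [RHS](_ : _ = \sum_(j | e i j) block_avg R[i] rt i l).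
  rewrite sumr_const -[RHS]mulr_natl; congr (_%:R * _).
  by apply: eq_card => j; rewrite inE.
rewrite mxE [RHS]big_mkcond; apply: eq_bigr => j _; rewrite [X in X * _]mxE.
case: ifP => [/e_rt rt_ij | _]; last by rewrite mul0r.
by rewrite mul1r !mxE rt_ij (eq_block_size rt_ij).
Qed.

Lemma unitmx_diag (K : fieldType) (m : nat) (v : 'rV[K]_m) :
  (forall j, v 0 j != 0) -> diag_mx v \in unitmx.
Proof.
by move=> v_neq0; rewrite unitmxE det_diag unitfE; apply/prodf_neq0.
Qed.

(** The Gram product is the transpose of [D *m D ^t*], invertible because the eigenvalues in [lam]
    are nonzero. *)
Lemma LG_frame_gram (R : realType) (n m : nat) (e : rel 'I_n)
    (rt : 'I_n -> 'I_n) (Phi : {ffun 'I_n -> 'rV[R[i]]_m}) :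
    (m <= n)%N -> (forall i j, e i j -> rt i = rt j) -> is_LG_frame e Phi ->
  (rows_mx Phi) ^t* *m rows_mx Phi \in unitmx /\
  block_avg _ rt *m rows_mx Phi = 0.
Proof.
move=> le_mn e_rt [_ [M [lam []]]].
set J : 'M[R[i]]_(n, m) := pid_mx m; set D := diag_mx (map_mx _ _).
move=> unitaryM lam_neq0 lapE PhiE.
set B := D *m _ in PhiE.
have -> : rows_mx Phi = B^T.
  by apply/row_matrixP => i; rewrite rowK PhiE tr_col.
have JJ : J^T *m J = 1%:M.
  by rewrite tr_pid_mx mul_pid_mx !minnn (minn_idPr le_mn) pid_mx_1.
have adjJ : J ^t* = J^T by rewrite tr_pid_mx map_pid_mx.
have MM : M ^t* *m M = 1%:M by apply: mulmx1C; apply/unitarymxP.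
have unitD : D \in unitmx.
  by apply: unitmx_diag => j; rewrite mxE sqrtC_eq0.
split.
  have -> : B^T ^t* *m B^T = (B *m B ^t*)^T.
    by rewrite [RHS]trmx_mul map_trmx.
  have MJ : (M *m J) ^t* *m (M *m J) = 1%:M.
    by rewrite adjmxM adjJ mulmxA -(mulmxA J^T) MM mulmx1 JJ.
  have -> : B ^t* = M *m J *m D ^t* by rewrite adjmxM trmxCK.
  rewrite unitmx_tr /B -(mulmxA D) (mulmxA ((M *m J) ^t*)) MJ mul1mx.
  by rewrite unitmx_mul unitD map_unitmx unitmx_tr.
(* Cancel M, J and the diagonal of eigenvalues, in this order, from the Laplacian times K being
   0. *)
have MK : J^T *m M ^t* *m block_avg _ rt = 0.
  have unit_lam := unitmx_diag lam_neq0.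
  set X := _ *m block_avg _ rt.
  have : J^T *m (M ^t* *m (laplacian R e *m block_avg _ rt)) = 0.
    by rewrite (laplacian_mul_block_avg R e_rt) !mulmx0.
  rewrite lapE.
  have -> : M *m (J *m diag_mx lam *m J^T) *m M ^t* *m block_avg _ rt =
      M *m (J *m (diag_mx lam *m X)).
    by rewrite /X !mulmxA.
  rewrite (mulmxA (M ^t*)) MM mul1mx mulmxA JJ mul1mx.
  by move/(congr1 (mulmx (invmx (diag_mx lam)))); rewrite mulKmx // mulmx0.
have BK : B *m block_avg _ rt = 0.
  by rewrite /B adjmxM adjJ -mulmxA MK mulmx0.
by apply: trmx_inj; rewrite trmx_mul trmxK tr_block_avg BK trmx0.
Qed.

Theorem theorem4p5 (R : realType) (n k : nat) (e : rel 'I_n)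
    (e_sym : symmetric e) (e_irr : irreflexive e)
    (ncomp_e : n_comp e 'I_n = k) (k_gt1 : (1 < k)%N)
    (dim_gt0 : (0 < n - k)%N)
    (Phi : {ffun 'I_n -> 'rV[R[i]]_(n - k)%N})
    (Phi_LG : is_LG_frame e Phi) :
  exists Psi : {ffun 'I_n -> 'rV[R[i]]_(n - k)%N},
    is_alternate_dual_frame Phi Psi /\ spectrally_optimal2 Phi Psi.
Proof.
have sym_e := sym_connect_sym e_sym.
have e_root i j : e i j -> fingraph.root e i = fingraph.root e j.
  by move=> e_ij; apply/(fingraph.rootP sym_e)/connect1.
have rootK i : fingraph.root e (fingraph.root e i) = fingraph.root e i.
  by apply: fingraph.root_root.
have card_roots : #|[pred i | fingraph.root e i == i]| = k.
  by rewrite -ncomp_e; apply: eq_card => i; rewrite !inE andbT.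
have [unitG KPhi] := LG_frame_gram (leq_subr k n) e_root Phi_LG.
have card_dim : (#|[pred i | fingraph.root e i == i]| + (n - k))%N = n.
  by rewrite card_roots subnKC // ltnW // -subn_gt0.
have projG := gram_proj rootK card_dim unitG KPhi.
(* As n > k, some vertex a is not a root; a and its root are then two vertices of one component. *)
have [a root_a] : exists a, fingraph.root e a != a.
  apply/existsP; apply: contraLR dim_gt0; rewrite negb_exists => /forallP all_roots.
  rewrite -leqNgt leqn0 subn_eq0 -card_roots -[leqLHS]card_ord.
  rewrite leq_eqVlt; apply/orP; left; apply/eqP/eq_card => i.
  by rewrite !inE -[RHS]negbK all_roots.
(* Of two distinct roots, at least one differs from the root of a. *)
have [i0 root_i0] : exists i0, fingraph.root e a != fingraph.root e i0.
  have : (1 < #|[pred i | fingraph.root e i == i]|)%N by rewrite card_roots.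
  case/card_gt1P => x [y []]; rewrite !inE => /eqP root_x /eqP root_y xy.
  have [ax | ax] := eqVneq (fingraph.root e a) x; last by exists x; rewrite root_x.
  by exists y; rewrite ax root_y.
have a_neq : a != fingraph.root e a by rewrite eq_sym.
exists (modified_dual (fingraph.root e) Phi i0 a); split; last first.
  by apply: (modified_dual_optimal KPhi projG unitG a_neq); rewrite ?rootK.
split; first exact: modified_dual_is_dual.
by apply: (modified_dual_neq_canonical projG a_neq); rewrite rootK.
Qed.
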